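(* Let $n,m$ be positive integers, and let $v_1,\ldots,v_m:S(\mathbb{C}^n)\to\mathbb{C}^n-\{0\}$ and $w_1,\ldots,w_m:S(\mathbb{H}^n)\to\mathbb{H}^n-\{0\}$ be continuous functions. Then: (i) $v_1,\ldots,v_m$ are linearly independent complex vector fields on $S(\mathbb{C}^n)$ if and only if the $2m$ functions $r_{\mathbb C}\circ v_1\circ r_{\mathbb C}^{-1},\ r_{\mathbb C}\circ\alpha_i\circ v_1\circ r_{\mathbb C}^{-1},\ldots,r_{\mathbb C}\circ v_m\circ r_{\mathbb C}^{-1},\ r_{\mathbb C}\circ\alpha_i\circ v_m\circ r_{\mathbb C}^{-1}$ are linearly independent real vector fields on $S(\mathbb{R}^{2n})$. (ii) $w_1,\ldots,w_m$ are linearly independent quaternionic vector fields on $S(\mathbb{H}^n)$ if and only if the $2m$ functions $c_{\mathbb H}\circ w_1\circ c_{\mathbb H}^{-1},\ c_{\mathbb H}\circ\alpha_j\circ w_1\circ c_{\mathbb H}^{-1},\ldots,c_{\mathbb H}\circ w_m\circ c_{\mathbb H}^{-1},\ c_{\mathbb H}\circ\alpha_j\circ w_m\circ c_{\mathbb H}^{-1}$ are linearly independent complex vector fields on $S(\mathbb{C}^{2n})$. (iii) $w_1,\ldots,w_m$ are linearly independent quaternionic vector fields on $S(\mathbb{H}^n)$ if and only if the $4m$ functions consisting of $r_{\mathbb H}\circ w_l\circ r_{\mathbb H}^{-1}$ and $r_{\mathbb H}\circ\alpha_t\circ w_l\circ r_{\mathbb H}^{-1}$ for $l=1,\ldots,m$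 and $t\in\{i,j,k\}$ are linearly independent real vector fields on $S(\mathbb{R}^{4n})$.
   Context: $\mathbb{F}$ denotes one of $\mathbb{R}$, $\mathbb{C}$, $\mathbb{H}$ with usual conjugation. $\mathbb{F}^n$ is a right inner product space over $\mathbb{F}$ with $\langle(x_1,\ldots,x_n)|(y_1,\ldots,y_n)\rangle_{\mathbb F}=\sum_{m=1}^n\bar{x}_m y_m$, and $S(\mathbb{F}^n)=\{x\in\mathbb{F}^n:\langle x|x\rangle_{\mathbb F}=1\}$. An $\mathbb{F}$-vector field on $S(\mathbb{F}^n)$ (real, complex, quaternionic for $\mathbb{F}=\mathbb{R},\mathbb{C},\mathbb{H}$) is a continuous function $v:S(\mathbb{F}^n)\to\mathbb{F}^n-\{0\}$ with $\langle x|v(x)\rangle_{\mathbb F}=0$ for every $x\in S(\mathbb{F}^n)$. $\mathbb{F}$-vector fields $v_1,\ldots,v_m$ on $S(\mathbb{F}^n)$ are linearly independent if $v_1(x),\ldots,v_m(x)$ are linearly independent over $\mathbb{F}$ (in the right $\mathbb{F}$-vector space $\mathbb{F}^n$) for all $x\in S(\mathbb{F}^n)$. The realification $r_{\mathbb C}:\mathbb{C}^n\to\mathbb{R}^{2n}$ is $r_{\mathbb C}(a_1+b_1i,\ldots,a_n+b_ni)=(a_1,b_1,\ldots,a_n,b_n)$. The complexification $c_{\mathbb H}:\mathbb{H}^n\to\mathbb{C}^{2n}$ is $c_{\mathbb H}(a_1+b_1i+c_1j+d_1k,\ldots,a_n+b_ni+c_nj+d_nk)=(a_1+b_1i,\,d_1+c_1i,\ldots,a_n+b_ni,\,d_n+c_ni)$.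 The realification $r_{\mathbb H}:\mathbb{H}^n\to\mathbb{R}^{4n}$ is $r_{\mathbb H}=r_{\mathbb C}\circ c_{\mathbb H}$. These are norm-preserving bijections, so they and their inverses restrict to the unit spheres. For $t\in\mathbb{F}$, $\alpha_t:\mathbb{F}^n\to\mathbb{F}^n$ is right multiplication, $\alpha_t(x)=x\cdot t$. *)

(* Defs.v *)
From HB Require Import structures.
From mathcomp Require Import all_boot all_order all_algebra.
From mathcomp Require Import ring.
From mathcomp Require Import all_classical all_reals topology normedtype.
From mathcomp Require Import complex.

Set Implicit Arguments.
Unset Strict Implicit.
Unset Printing Implicit Defensive.

Import Order.TTheory GRing.Theory Num.Theory.
Import numFieldNormedType.Exports.

Local Open Scope classical_set_scope.
Local Open Scope ring_scope.

(* [Quat a b c d] stands for a + b i + c j + d k. *)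
Record quaternion (R : Type) : Type :=
  Quat { qre : R; qim_i : R; qim_j : R; qim_k : R }.

Section QuaternionCoordinates.
Variable R : Type.

Definition quat_coords (q : quaternion R) : R * R * R * R :=
  (qre q, qim_i q, qim_j q, qim_k q).

Definition quat_of_coords (p : R * R * R * R) : quaternion R :=
  Quat p.1.1.1 p.1.1.2 p.1.2 p.2.

Lemma quat_coordsK : cancel quat_coords quat_of_coords.
Proof. by case. Qed.

End QuaternionCoordinates.

HB.instance Definition _ (R : eqType) :=
  Equality.copy (quaternion R) (can_type (@quat_coordsK R)).
HB.instance Definition _ (R : choiceType) :=
  Choice.copy (quaternion R) (can_type (@quat_coordsK R)).

Section QuaternionZmodule.
Variable R : zmodType.
Implicit Types p q : quaternion R.

Definition quat_add p q :=
  Quat (qre p + qre q) (qim_i p + qim_i q)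
       (qim_j p + qim_j q) (qim_k p + qim_k q).
Definition quat_opp p :=
  Quat (- qre p) (- qim_i p) (- qim_j p) (- qim_k p).
Definition quat_zero : quaternion R := Quat 0 0 0 0.

Lemma quat_addA : associative quat_add.
Proof. by move=> [? ? ? ?] [? ? ? ?] [? ? ? ?]; rewrite /quat_add /= !addrA. Qed.
Lemma quat_addC : commutative quat_add.
Proof.
by move=> [a b c d] [a' b' c' d']; congr Quat; rewrite /= addrC.
Qed.
Lemma quat_add0 : left_id quat_zero quat_add.
Proof. by move=> [? ? ? ?]; rewrite /quat_add /= !add0r. Qed.
Lemma quat_addN : left_inverse quat_zero quat_opp quat_add.
Proof. by move=> [? ? ? ?]; rewrite /quat_add /= !addNr. Qed.

HB.instance Definition _ := GRing.isZmodule.Build (quaternion R)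
  quat_addA quat_addC quat_add0 quat_addN.

End QuaternionZmodule.

Section QuaternionRing.
Variable R : comNzRingType.
Implicit Types p q : quaternion R.

Definition quat_one : quaternion R := Quat 1 0 0 0.

(* Hamilton's relations i^2 = j^2 = k^2 = ijk = -1. *)
Definition quat_mul p q :=
  let: Quat a b c d := p in
  let: Quat a' b' c' d' := q in
  Quat (a * a' - b * b' - c * c' - d * d')
       (a * b' + b * a' + c * d' - d * c')
       (a * c' - b * d' + c * a' + d * b')
       (a * d' + b * c' - c * b' + d * a').

Lemma quat_mulA : associative quat_mul.
Proof. by move=> [? ? ? ?] [? ? ? ?] [? ? ? ?]; congr Quat; ring. Qed.
Lemma quat_mul1l : left_id quat_one quat_mul.
Proof. by move=> [? ? ? ?]; congr Quat; ring. Qed.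
Lemma quat_mul1r : right_id quat_one quat_mul.
Proof. by move=> [? ? ? ?]; congr Quat; ring. Qed.
Lemma quat_mulDl : left_distributive quat_mul +%R.
Proof. by move=> [? ? ? ?] [? ? ? ?] [? ? ? ?]; congr Quat => /=; ring. Qed.
Lemma quat_mulDr : right_distributive quat_mul +%R.
Proof. by move=> [? ? ? ?] [? ? ? ?] [? ? ? ?]; congr Quat => /=; ring. Qed.
Lemma quat_one_neq0 : quat_one != 0.
Proof. by apply/eqP => -[/eqP]; rewrite oner_eq0. Qed.

HB.instance Definition _ := GRing.Zmodule_isNzRing.Build (quaternion R)
  quat_mulA quat_mul1l quat_mul1r quat_mulDl quat_mulDr quat_one_neq0.

Definition quat_i : quaternion R := Quat 0 1 0 0.
Definition quat_j : quaternion R := Quat 0 0 1 0.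
Definition quat_k : quaternion R := Quat 0 0 0 1.

Definition quat_conj q := Quat (qre q) (- qim_i q) (- qim_j q) (- qim_k q).

End QuaternionRing.

HB.instance Definition _ (R : topologicalType) :=
  Topological.copy (quaternion R) (initial_topology (@quat_coords R)).

HB.instance Definition _ (R : realType) := NormedModule.copy R[i] R[i]^o.

HB.mixin Record hasConjugation F of GRing.NzRing F := {
  conjF : F -> F;
  conjFD : {morph conjF : x y / x + y};
  conjFM : forall x y, conjF (x * y) = conjF y * conjF x;
  conjFK : involutive conjF }.

#[short(type="topConjRingType")]
HB.structure Definition TopConjRing :=
  { F of GRing.NzRing F & Topological F & hasConjugation F }.

Section RealConjugation.
Variable R : realType.

Lemma conj_realD : {morph @idfun R : x y / x + y}.
Proof. by []. Qed.
Lemma conj_realM (x y : R) : idfun (x * y) = idfun y * idfun x.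
Proof. exact: mulrC. Qed.
Lemma conj_realK : involutive (@idfun R).
Proof. by []. Qed.

#[non_forgetful_inheritance]
HB.instance Definition _ := hasConjugation.Build R
  conj_realD conj_realM conj_realK.

End RealConjugation.

Section ComplexConjugation.
Variable R : realType.

Lemma conj_complexD : {morph @conjc R : x y / x + y}.
Proof. exact: rmorphD. Qed.
Lemma conj_complexM (x y : R[i]) : conjc (x * y) = conjc y * conjc x.
Proof. by rewrite rmorphM mulrC. Qed.

HB.instance Definition _ := hasConjugation.Build R[i]
  conj_complexD conj_complexM (@conjcK R).

End ComplexConjugation.

Section QuaternionConjugation.
Variable R : realType.

Lemma quat_conjD : {morph @quat_conj R : x y / x + y}.
Proof. by move=> [? ? ? ?] [? ? ? ?]; congr Quat => /=; ring. Qed.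
Lemma quat_conjM (x y : quaternion R) :
  quat_conj (x * y) = quat_conj y * quat_conj x.
Proof. by case: x => ? ? ? ?; case: y => ? ? ? ?; congr Quat => /=; ring. Qed.
Lemma quat_conjK : involutive (@quat_conj R).
Proof. by move=> [? ? ? ?]; congr Quat => /=; ring. Qed.

HB.instance Definition _ := hasConjugation.Build (quaternion R)
  quat_conjD quat_conjM quat_conjK.

End QuaternionConjugation.

(* The space F^n is ['rV[F]_n], with scalars acting on the right. *)
Section VectorFields.
Variables (F : topConjRingType) (n : nat).
Implicit Types x y : 'rV[F]_n.

Definition alpha (t : F) x : 'rV[F]_n := \row_j (x 0 j * t).

Definition inner x y : F := \sum_j conjF (x 0 j) * y 0 j.

Definition sphere : set 'rV[F]_n := [set x | inner x x = 1].

Definition right_independent (I : finType) (u : I -> 'rV[F]_n) : Prop :=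
  forall c : I -> F, \sum_i alpha (c i) (u i) = 0 -> forall i, c i = 0.

(* A map S(F^n) -> F^n - {0} is represented by a total function, of which
   only the restriction to the sphere matters. *)
Definition continuous_nonvanishing (v : 'rV[F]_n -> 'rV[F]_n) : Prop :=
  {within sphere, continuous v} /\ forall x, sphere x -> v x != 0.

Definition vector_field (v : 'rV[F]_n -> 'rV[F]_n) : Prop :=
  continuous_nonvanishing v /\ forall x, sphere x -> inner x (v x) = 0.

Definition independent_vector_fields (I : finType)
    (v : I -> 'rV[F]_n -> 'rV[F]_n) : Prop :=
  (forall i, vector_field (v i)) /\
  (forall x, sphere x -> right_independent (fun i => v i x)).

End VectorFields.

Section Interleave.
Variables (A B : Type) (n : nat).

Lemma half_ord_subproof (p : 'I_(2 * n)) : (p./2 < n)%N.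
Proof. by rewrite ltn_half_double -mul2n. Qed.
Definition half_ord (p : 'I_(2 * n)) : 'I_n := Ordinal (half_ord_subproof p).

Lemma double_ord_subproof (b : bool) (l : 'I_n) : (b + l.*2 < 2 * n)%N.
Proof. by rewrite mul2n -ltn_half_double half_bit_double. Qed.
Definition double_ord (b : bool) (l : 'I_n) : 'I_(2 * n) :=
  Ordinal (double_ord_subproof b l).

(* (x_1, ..., x_n) |-> (f x_1, g x_1, ..., f x_n, g x_n) *)
Definition interleave (f g : A -> B) (x : 'rV[A]_n) : 'rV[B]_(2 * n) :=
  \row_p let z := x 0 (half_ord p) in if odd p then g z else f z.

(* (y_1, ..., y_2n) |-> (h y_1 y_2, ..., h y_(2n-1) y_2n) *)
Definition deinterleave (h : B -> B -> A) (y : 'rV[B]_(2 * n)) : 'rV[A]_n :=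
  \row_l h (y 0 (double_ord false l)) (y 0 (double_ord true l)).

Lemma interleaveK f g h : (forall a, h (f a) (g a) = a) ->
  cancel (interleave f g) (deinterleave h).
Proof.
move=> fgh x; apply/rowP => l.
have half_double b : half_ord (double_ord b l) = l.
  by apply: val_inj; exact: half_bit_double.
by rewrite !mxE !half_double /= !odd_double /=.
Qed.

Lemma deinterleaveK f g h :
  (forall b c, f (h b c) = b) -> (forall b c, g (h b c) = c) ->
  cancel (deinterleave h) (interleave f g).
Proof.
move=> fh gh y; apply/rowP => p; rewrite !mxE /= fh gh.
have double_half : double_ord (odd p) (half_ord p) = p.
  by apply: val_inj; exact: odd_double_half.
by rewrite -[in RHS]double_half; case: odd.
Qed.

End Interleave.

Section Realification.
Variables (R : realType) (n : nat).

Definition rC : 'rV[R[i]]_n -> 'rV[R]_(2 * n) :=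
  interleave (@complex.Re R) (@complex.Im R).
Definition rC_inv : 'rV[R]_(2 * n) -> 'rV[R[i]]_n :=
  deinterleave (@Complex R).

Lemma rCK : cancel rC rC_inv.
Proof. by apply: interleaveK; case. Qed.
Lemma rC_invK : cancel rC_inv rC.
Proof. exact: deinterleaveK. Qed.

Definition cH : 'rV[quaternion R]_n -> 'rV[R[i]]_(2 * n) :=
  interleave (fun q => Complex (qre q) (qim_i q))
             (fun q => Complex (qim_k q) (qim_j q)).
Definition cH_inv : 'rV[R[i]]_(2 * n) -> 'rV[quaternion R]_n :=
  deinterleave (fun z u : R[i] =>
    Quat (complex.Re z) (complex.Im z) (complex.Im u) (complex.Re u)).

Lemma cHK : cancel cH cH_inv.
Proof. by apply: interleaveK; case. Qed.
Lemma cH_invK : cancel cH_inv cH.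
Proof. by apply: deinterleaveK => - [? ?] [? ?]. Qed.

End Realification.

Section QuaternionRealification.
Variables (R : realType) (n : nat).

Definition rH : 'rV[quaternion R]_n -> 'rV[R]_(2 * (2 * n)) :=
  @rC R (2 * n) \o @cH R n.
Definition rH_inv : 'rV[R]_(2 * (2 * n)) -> 'rV[quaternion R]_n :=
  @cH_inv R n \o @rC_inv R (2 * n).

Lemma rHK : cancel rH rH_inv.
Proof. by move=> x; rewrite /rH_inv /rH /= rCK cHK. Qed.
Lemma rH_invK : cancel rH_inv rH.
Proof. by move=> y; rewrite /rH_inv /rH /= cH_invK rC_invK. Qed.

End QuaternionRealification.

(* Main.v *)
(* Let K be a subfield of the (skew) field F, let e_t be a basis of F as a right
   K-space, and identify F^n with K^N as right K-spaces.  A family (v_l) is then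
   independent over F iff (v_l e_t) is independent over K.  The K-inner product
   of the images of x and y is a K-component of <x|y>, and q = <x|v> vanishes
   iff this component of q e_t vanishes for every t, because
   <x|v e_t> = <x|v> e_t.  All three parts are instances of this. *)
Require Import Defs.
From HB Require Import structures.
From mathcomp Require Import all_boot all_order all_algebra.
From mathcomp Require Import ring.
From mathcomp Require Import all_classical all_reals topology normedtype.
From mathcomp Require Import complex.

Set Implicit Arguments.
Unset Strict Implicit.
Unset Printing Implicit Defensive.

Import Order.TTheory GRing.Theory Num.Theory.
Import numFieldNormedType.Exports.

Local Open Scope ring_scope.

(** * Continuity of maps from and to matrices, entry by entry *)

Section MatrixContinuity.
Variables (S T : topologicalType) (m n : nat).

Lemma mx_entry_continuous (i : 'I_m) (j : 'I_n) :
  continuous (fun M : 'M[T]_(m, n) => M i j).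
Proof.
move=> M A nA.
(* The basic neighbourhoods are boxes: [A] constrains one entry and every other entry is free. *)
exists (fun i' j' => if (i' == i) && (j' == j) then A else setT).
  move=> i' j'; case: ifP => [/andP[/eqP -> /eqP ->] //|_]; exact: filterT.
by move=> N /(_ i j) /=; rewrite !eqxx.
Qed.

Lemma continuous_mx (f : S -> 'M[T]_(m, n)) :
  (forall i j, continuous (fun x => f x i j)) -> continuous f.
Proof.
move=> cf x A [P nP sPA].
have : \forall y \near x, forall i j, P i j (f y i j).
  apply: filter_forall => i; apply: filter_forall => j.
  exact: (cf i j x _ (nP i j)).
by apply: filterS => y Py; apply: sPA.
Qed.

End MatrixContinuity.

(** * Real and imaginary parts, and assembling a complex number from them *)

Section ComplexContinuity.
Variable R : realType.

Lemma Re_continuous : continuous (@complex.Re R).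
Proof.
move=> z A /nbhs_ballP[e /= e0 sA].
apply/nbhs_ballP; exists e%:C%C => [|y yz]; first by rewrite /= ltcR.
apply: sA; move: yz; rewrite /ball /= => yz.
rewrite -ltcR; apply: le_lt_trans yz.
by rewrite -raddfB; exact: normc_ge_Re.
Qed.

Lemma Im_continuous : continuous (@complex.Im R).
Proof.
(* Multiplication by -i turns the imaginary part into the real part. *)
have -> : @complex.Im R = @complex.Re R \o ( *%R (Complex 0 (-1))).
  by apply/funext => -[a b] /=; ring.
move=> z; apply: continuous_comp; last exact: Re_continuous.
exact: mulrl_continuous.
Qed.

Lemma real_complex_continuous : continuous (@real_complex R).
Proof.
(* A ball of [R[i]] has its radius in [R[i]]; positivity forces the imaginary part of the radius to
   be 0. *)
move=> x A /nbhs_ballP[[e e'] /=]; rewrite ltcE /= => /andP[/eqP -> e0] sA.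
apply/nbhs_ballP; exists e => // y xy; apply: sA; move: xy; rewrite /ball /=.
by rewrite -rmorphB /= normc_def /= expr0n addr0 sqrtr_sqr ltcR.
Qed.

Lemma continuous_Complex (S : topologicalType) (f g : S -> R) :
  continuous f -> continuous g -> continuous (fun x => Complex (f x) (g x)).
Proof.
move=> cf cg.
have -> : (fun x => Complex (f x) (g x)) =
    (fun x => (f x)%:C%C + Complex 0 1 * (g x)%:C%C).
  by apply/funext => x; apply/eqP; rewrite eq_complex /=; apply/andP; split;
    apply/eqP; ring.
move=> x; apply: cvgD.
  by apply: (continuous_comp (cf x)); exact: real_complex_continuous.
apply: cvgMr; apply: (continuous_comp (cg x)).
exact: real_complex_continuous.
Qed.

End ComplexContinuity.

(** * Quaternion coordinates and multiplication by a fixed quaternion *)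

Section QuaternionContinuity.
Variable R : topologicalType.

Lemma quat_coords_continuous : continuous (@quat_coords R).
Proof. exact: initial_continuous. Qed.

Lemma qre_continuous : continuous (@qre R).
Proof.
move=> q.
change ({for q, continuous (fst \o (fst \o (fst \o (@quat_coords R))))}).
apply: continuous_comp; last exact: cvg_fst.
apply: continuous_comp; last exact: cvg_fst.
apply: continuous_comp; last exact: cvg_fst.
exact: quat_coords_continuous.
Qed.

Lemma qim_i_continuous : continuous (@qim_i R).
Proof.
move=> q.
change ({for q, continuous (snd \o (fst \o (fst \o (@quat_coords R))))}).
apply: continuous_comp; last exact: cvg_snd.
apply: continuous_comp; last exact: cvg_fst.
apply: continuous_comp; last exact: cvg_fst.
exact: quat_coords_continuous.
Qed.

Lemma qim_j_continuous : continuous (@qim_j R).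
Proof.
move=> q.
change ({for q, continuous (snd \o (fst \o (@quat_coords R)))}).
apply: continuous_comp; last exact: cvg_snd.
apply: continuous_comp; last exact: cvg_fst.
exact: quat_coords_continuous.
Qed.

Lemma qim_k_continuous : continuous (@qim_k R).
Proof.
move=> q.
change ({for q, continuous (snd \o (@quat_coords R))}).
apply: continuous_comp; last exact: cvg_snd.
exact: quat_coords_continuous.
Qed.

(** The quaternions carry the initial topology of [quat_coords], so continuity into them is tested
    on coordinates. *)
Lemma continuous_Quat (S : topologicalType) (a b c d : S -> R) :
  continuous a -> continuous b -> continuous c -> continuous d ->
  continuous (fun x => Quat (a x) (b x) (c x) (d x)).
Proof.
move=> ca cb cc cd.
apply: (@continuous_comp_initial _ _ _ (@quat_coords R)) => x.
exact: (cvg_pair (cvg_pair (cvg_pair (ca x) (cb x)) (cc x)) (cd x)).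
Qed.

End QuaternionContinuity.

(** Each coordinate of [q * t], for fixed [t], has this form in the coordinates of [q]. *)
Lemma continuous_lincomb4 (R : realType) (S : topologicalType)
    (f g h k : S -> R) (a b c d : R) :
  continuous f -> continuous g -> continuous h -> continuous k ->
  continuous (fun x => f x * a + g x * b + h x * c + k x * d).
Proof.
move=> cf cg ch ck x.
by repeat first [apply: cvgD | apply: cvgMl];
  [exact: cf | exact: cg | exact: ch | exact: ck].
Qed.

Lemma quat_mulr_continuous (R : realType) (t : quaternion R) :
  continuous (fun q => q * t).
Proof.
case: t => a b c d.
have -> : (fun q => q * Quat a b c d) = (fun q =>
   Quat (qre q * a + qim_i q * - b + qim_j q * - c + qim_k q * - d)
        (qre q * b + qim_i q * a + qim_j q * d + qim_k q * - c)
        (qre q * c + qim_i q * - d + qim_j q * a + qim_k q * b)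
        (qre q * d + qim_i q * c + qim_j q * - b + qim_k q * a)).
  by apply/funext => -[? ? ? ?]; congr Quat => /=; ring.
apply: continuous_Quat; apply: continuous_lincomb4;
  first [exact: qre_continuous | exact: qim_i_continuous
        | exact: qim_j_continuous | exact: qim_k_continuous].
Qed.

(** * Right multiplication and the inner product *)

Section Alpha.
Variables (F : topConjRingType) (n : nat).
Implicit Types (x y : 'rV[F]_n) (s t : F).

Lemma alpha1 x : alpha 1 x = x.
Proof. by apply/rowP => j; rewrite mxE mulr1. Qed.

Lemma alpha_alpha s t x : alpha t (alpha s x) = alpha (s * t) x.
Proof. by apply/rowP => j; rewrite !mxE mulrA. Qed.

Lemma alpha0 t : alpha t 0 = 0 :> 'rV[F]_n.
Proof. by apply/rowP => j; rewrite !mxE mul0r. Qed.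

Lemma alpha_suml (I : finType) (c : I -> F) x :
  alpha (\sum_i c i) x = \sum_i alpha (c i) x.
Proof.
apply/rowP => j; rewrite !mxE summxE mulr_sumr.
by apply: eq_bigr => i _; rewrite mxE.
Qed.

Lemma innerZr t x y : inner x (alpha t y) = inner x y * t.
Proof.
by rewrite /inner mulr_suml; apply: eq_bigr => j _; rewrite mxE mulrA.
Qed.

Lemma conjF0 : conjF (0 : F) = 0.
Proof. by apply: (addrI (conjF (0 : F))); rewrite -conjFD !addr0. Qed.

(** Conjugation is an involution reversing products, so it fixes each term of the sum. *)
Lemma conjF_inner x : conjF (inner x x) = inner x x.
Proof.
rewrite /inner (big_morph _ (@conjFD F) conjF0).
by apply: eq_bigr => j _; rewrite conjFM conjFK.
Qed.

(** A [topConjRingType] does not relate topology and multiplication, so continuity of scalar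
    multiplication enters as a hypothesis. *)
Lemma alpha_continuous t :
  continuous (fun s => s * t) -> continuous (@alpha F n t).
Proof.
move=> ct; apply: continuous_mx => i j.
have -> : (fun x => alpha t x i j) =
    (fun s => s * t) \o (fun x : 'rV[F]_n => x 0 j).
  by apply/funext => x; rewrite /= mxE.
move=> x; apply: continuous_comp; last exact: ct.
exact: mx_entry_continuous.
Qed.

End Alpha.

(** * Restriction of scalars from F to K *)

(* [phi] identifies F^n with K^N, [iota] embeds the scalars K into F, and
   [proj : F -> K] expresses the K-inner product through the F-inner product. *)
Record scalar_restriction (F K : topConjRingType) (n N : nat)
    (phi : 'rV[F]_n -> 'rV[K]_N) (psi : 'rV[K]_N -> 'rV[F]_n)
    (iota : K -> F) (proj : F -> K) : Prop := ScalarRestriction {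
  restrK : cancel phi psi;
  restr_invK : cancel psi phi;
  restr_continuous : continuous phi;
  restr_inv_continuous : continuous psi;
  restrD : {morph phi : x y / x + y};
  restr_alpha : forall k x, phi (alpha (iota k) x) = alpha k (phi x);
  restr_inner : forall x y, inner (phi x) (phi y) = proj (inner x y) }.

(** Yields the passage from quaternions to reals through the complex numbers. *)
Lemma scalar_restriction_comp (F K L : topConjRingType) (n N M : nat)
    (phi : 'rV[F]_n -> 'rV[K]_N) psi iota proj
    (phi' : 'rV[K]_N -> 'rV[L]_M) psi' iota' proj' :
  scalar_restriction phi psi iota proj ->
  scalar_restriction phi' psi' iota' proj' ->
  scalar_restriction (phi' \o phi) (psi \o psi') (iota \o iota')
    (proj' \o proj).
Proof.
move=> [a1 a2 a3 a4 a5 a6 a7] [b1 b2 b3 b4 b5 b6 b7]; split => /=.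
- exact: can_comp.
- exact: can_comp.
- by move=> x; apply: continuous_comp; [exact: a3|exact: b3].
- by move=> x; apply: continuous_comp; [exact: b4|exact: a4].
- by move=> x y /=; rewrite a5 b5.
- by move=> k x /=; rewrite a6 b6.
- by move=> x y /=; rewrite b7 a7.
Qed.

(** * Restriction of scalars by splitting each coordinate in two *)

Section Interleaving.
Variable n : nat.

Lemma half_double_ord (b : bool) (l : 'I_n) : half_ord (double_ord b l) = l.
Proof. by apply: val_inj; exact: half_bit_double. Qed.

Lemma odd_double_ord (b : bool) (l : 'I_n) : odd (double_ord b l) = b.
Proof. by rewrite /= oddD odd_double addbF oddb. Qed.

Lemma double_half_ord (p : 'I_(2 * n)) : double_ord (odd p) (half_ord p) = p.
Proof. by apply: val_inj; exact: odd_double_half. Qed.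

(** An index below [2 * n] amounts to its half together with its parity. *)
Lemma sum_double_ord (V : nmodType) (E : 'I_(2 * n) -> V) :
  \sum_p E p = \sum_l (E (double_ord false l) + E (double_ord true l)).
Proof.
rewrite (reindex (fun lb : 'I_n * bool => double_ord lb.2 lb.1)) /=; last first.
  exists (fun p => (half_ord p, odd p)) => [[l b] _|p _] /=.
    by rewrite half_double_ord odd_double_ord.
  exact: double_half_ord.
rewrite -(pair_bigA _ (fun l b => E (double_ord b l))) /=.
by apply: eq_bigr => l _; rewrite big_bool /= addrC.
Qed.

Variables (F K : topConjRingType) (f g : F -> K) (h : K -> K -> F).
Variables (iota : K -> F) (proj : F -> K).
Hypotheses (fD : {morph f : x y / x + y}) (gD : {morph g : x y / x + y})
  (projD : {morph proj : x y / x + y}).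
Hypotheses (f_cont : continuous f) (g_cont : continuous g)
  (h_cont : continuous (fun p : K * K => h p.1 p.2)).
Hypotheses (hfg : forall a, h (f a) (g a) = a)
  (fh : forall b c, f (h b c) = b) (gh : forall b c, g (h b c) = c).
Hypotheses (f_iota : forall q k, f (q * iota k) = f q * k)
  (g_iota : forall q k, g (q * iota k) = g q * k).
(** The inner product formula for a single coordinate; summed over all coordinates it becomes
    [restr_inner]. *)
Hypothesis proj_conj : forall p q,
  conjF (f p) * f q + conjF (g p) * g q = proj (conjF p * q).

Lemma interleave_restriction :
  scalar_restriction (interleave (n := n) f g) (deinterleave h) iota proj.
Proof.
split.
- exact: interleaveK.
- exact: deinterleaveK.
- apply: continuous_mx => i p.
  have -> : (fun x => interleave f g x i p) =
      (if odd p then g else f) \o (fun x : 'rV[F]_n => x 0 (half_ord p)).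
    by apply/funext => x; rewrite mxE /=; case: ifP.
  move=> x; apply: continuous_comp; first exact: mx_entry_continuous.
  by case: odd; [exact: g_cont | exact: f_cont].
- apply: continuous_mx => i l.
  have -> : (fun y => deinterleave h y i l) =
      (fun p => h p.1 p.2) \o
      (fun y : 'rV[K]_(2 * n) =>
        (y 0 (double_ord false l), y 0 (double_ord true l))).
    by apply/funext => y; rewrite mxE.
  move=> y; apply: continuous_comp; last exact: h_cont.
  exact: (cvg_pair (mx_entry_continuous (x := y))
    (mx_entry_continuous (x := y))).
- by move=> x y; apply/rowP => p; rewrite !mxE /=; case: ifP.
- by move=> k x; apply/rowP => p; rewrite !mxE /=; case: ifP.
- move=> x y; rewrite /inner sum_double_ord.
  have proj0 : proj 0 = 0.
    by apply: (addrI (proj 0)); rewrite -projD !addr0.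
  rewrite (big_morph _ projD proj0); apply: eq_bigr => l _.
  by rewrite !mxE !half_double_ord !odd_double_ord.
Qed.

End Interleaving.

(** * Transfer of independent vector fields along a restriction of scalars *)

Section RestrictionOfFields.
Variables (F K : topConjRingType) (n N : nat).
Variables (phi : 'rV[F]_n -> 'rV[K]_N) (psi : 'rV[K]_N -> 'rV[F]_n).
Variables (iota : K -> F) (proj : F -> K).
Hypothesis phiP : scalar_restriction phi psi iota proj.
Hypotheses (iota0 : iota 0 = 0) (proj0 : proj 0 = 0) (proj1 : proj 1 = 1).
(** Over K only the projection of <x|x> is visible. Since <x|x> is self-conjugate, it equals 1 as
    soon as its projection does, so the two unit spheres correspond. *)
Hypothesis proj_conj1 : forall q, conjF q = q -> proj q = 1 -> q = 1.

(** [e] is the basis of F over K, [e'] lists right inverses of its elements, and [coord] gives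
    coordinates in it. *)
Variables (T : finType) (e e' : T -> F) (coord : F -> T -> K).
Hypothesis e_unit : forall t, e t * e' t = 1.
Hypothesis e_continuous : forall t, continuous (fun q => q * e t).
Hypothesis e_span : forall q, \sum_t e t * iota (coord q t) = q.
Hypothesis e_free : forall d : T -> K,
  \sum_t e t * iota (d t) = 0 -> forall t, d t = 0.
Hypothesis proj_e : forall q, (forall t, proj (q * e t) = 0) -> q = 0.

(** [J] indexes the enlarged family in whatever shape it is stated; [h] reads an index as a field
    together with a basis element. *)
Variables (I J : finType) (h : J -> I * T) (h' : I * T -> J).
Hypotheses (hK : cancel h h') (h'K : cancel h' h).

Lemma restr0 : phi 0 = 0.
Proof.
by apply: (addrI (phi 0)); rewrite -(restrD phiP) !addr0.
Qed.

Lemma sphere_restr x : sphere (phi x) <-> sphere x.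
Proof.
rewrite /sphere /= (restr_inner phiP); split => [|->//].
exact/proj_conj1/conjF_inner.
Qed.

Lemma sphere_restr_inv y : sphere y <-> sphere (psi y).
Proof. by rewrite -sphere_restr (restr_invK phiP). Qed.

Lemma restr_alpha_neq0 t x : x != 0 -> phi (alpha (e t) x) != 0.
Proof.
apply: contra_neq => px0; have : alpha (e t) x = 0.
  by rewrite -(restrK phiP (alpha _ _)) px0 -restr0 (restrK phiP).
by move=> /(congr1 (alpha (e' t))); rewrite alpha_alpha e_unit alpha1 alpha0.
Qed.

(** Regrouping by [l] turns a K-combination of the v_l e_t into an F-combination of the v_l whose
    coefficients are expansions in the basis [e]. Both directions of the independence claim rest on
    this. *)
Lemma sum_restr_alpha (d : J -> K) (v : I -> 'rV[F]_n) :
  \sum_s alpha (d s) (phi (alpha (e (h s).2) (v (h s).1))) =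
  phi (\sum_l alpha (\sum_t e t * iota (d (h' (l, t)))) (v l)).
Proof.
transitivity (phi (\sum_l \sum_t alpha (e t * iota (d (h' (l, t)))) (v l)));
  last by congr phi; apply: eq_bigr => l _; rewrite alpha_suml.
rewrite pair_bigA /= (reindex h) /=; last by exists h' => s _; rewrite ?hK ?h'K.
rewrite (big_morph _ (restrD phiP) restr0); apply: eq_bigr => s _.
by rewrite -surjective_pairing hK -(restr_alpha phiP) alpha_alpha.
Qed.

Lemma restr_within_continuous t (v : 'rV[F]_n -> 'rV[F]_n) :
  {within @sphere F n, continuous v}%classic ->
  {within @sphere K N, continuous (phi \o alpha (e t) \o v \o psi)}%classic.
Proof.
move=> /subspace_continuousP cv; apply/subspace_continuousP => y Sy.
have Sx : sphere (psi y) by exact/sphere_restr_inv.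
(* [psi] sends sphere to sphere, so its continuity passes to the relative neighbourhoods. *)
have cpsi : (psi @ within (@sphere K N) (nbhs y)
    `=>` within (@sphere F n) (nbhs (psi y)))%classic.
  move=> A nA.
  have nA' : \forall z \near y, sphere (psi z) -> A (psi z).
    exact: (restr_inv_continuous phiP nA).
  change (\forall z \near y, sphere z -> A (psi z)).
  by apply: filterS nA' => z zA Sz; apply: zA; exact/sphere_restr_inv.
have cvpsi := cvg_comp _ _ cpsi (cv _ Sx).
have phialpha : {for v (psi y), continuous (phi \o alpha (e t))}.
  apply: continuous_comp; last exact: (restr_continuous phiP).
  exact/alpha_continuous/e_continuous.
exact: (cvg_comp _ _ cvpsi phialpha).
Qed.

Lemma independent_vector_fields_restr (v : I -> 'rV[F]_n -> 'rV[F]_n)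
    (u : J -> 'rV[K]_N -> 'rV[K]_N) :
  (forall l, continuous_nonvanishing (v l)) ->
  (forall s, u s = phi \o alpha (e (h s).2) \o v (h s).1 \o psi) ->
  independent_vector_fields v <-> independent_vector_fields u.
Proof.
move=> v_cn uE; split=> [[vf vfree]|[uf ufree]]; split.
- move=> s; rewrite uE; have [[cv v0] vt] := vf (h s).1.
  split=> [|y /sphere_restr_inv Sy].
    split=> [|y /sphere_restr_inv Sy /=]; first exact: restr_within_continuous.
    exact/restr_alpha_neq0/v0.
  (* With [y] written as [phi (psi y)], the K-inner product is the projection of <x|v> e_t, which is
     0. *)
  rewrite /= -{1}(restr_invK phiP y) (restr_inner phiP) innerZr vt //.
  by rewrite mul0r.
- move=> y /sphere_restr_inv Sy d.
  under eq_bigr do rewrite uE /=.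
  rewrite (sum_restr_alpha d (fun l => v l (psi y))) -[in X in _ = X]restr0.
  (* Independence over F kills each coefficient of a v_l; freeness of [e] then kills every [d s]. *)
  move=> /(can_inj (restrK phiP)) /(vfree _ Sy) d0 s.
  by have /e_free /(_ (h s).2) := d0 (h s).1; rewrite -surjective_pairing hK.
- move=> l; split=> [|x /sphere_restr Sx]; first exact: v_cn.
  (* Tangency over K only gives that <x|v_l> e_t projects to 0; letting [t] run over the whole basis
     recovers <x|v_l> = 0. *)
  apply: proj_e => t; have [_] := uf (h' (l, t)); rewrite uE h'K /=.
  move=> /(_ _ Sx); rewrite (restrK phiP) (restr_inner phiP).
  by rewrite innerZr.
- move=> x /sphere_restr Sx c cv0 l.
  (* The K-coefficients are the coordinates of the [c l]; once they vanish, so does each [c l]. *)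
  have {}ufree := ufree _ Sx (fun s => coord (c (h s).1) (h s).2).
  rewrite -[c l]e_span big1 // => t _.
  rewrite (_ : coord (c l) t = 0) ?iota0 ?mulr0 //.
  have -> : coord (c l) t = coord (c (h (h' (l, t))).1) (h (h' (l, t))).2.
    by rewrite h'K.
  apply: ufree; under eq_bigr do rewrite uE /= (restrK phiP).
  rewrite (sum_restr_alpha _ (fun l => v l x)) -[RHS]restr0; congr phi.
  rewrite -[RHS]cv0; apply: eq_bigr => k _; congr alpha.
  by under eq_bigr do rewrite h'K /=; exact: e_span.
Qed.

End RestrictionOfFields.

(** * The three restrictions: complex to real, quaternionic to complex, quaternionic to real *)

Section Restrictions.
Variable R : realType.

Lemma rC_restriction n :
  scalar_restriction (@rC R n) (@rC_inv R n) (@real_complex R) (@complex.Re R).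
Proof.
apply: interleave_restriction.
- exact: raddfD.
- exact: raddfD.
- exact: raddfD.
- exact: Re_continuous.
- exact: Im_continuous.
- by apply: continuous_Complex => p; [exact: cvg_fst | exact: cvg_snd].
- by case.
- by [].
- by [].
- by move=> [a b] k /=; ring.
- by move=> [a b] k /=; ring.
- by move=> [a b] [c d]; rewrite /conjF /=; ring.
Qed.

Definition quat_of_complex (z : R[i]) : quaternion R :=
  Quat (complex.Re z) (complex.Im z) 0 0.

(** The projection onto C along H = C + jC. *)
Definition complex_of_quat (q : quaternion R) : R[i] :=
  Complex (qre q) (qim_i q).

(** Since ki = j, a + bi + cj + dk = (a + bi) + k(d + ci). Thus [cH] takes coordinates in the right
    C-basis 1, k, which makes it right C-linear despite the swapped order of c and d. *)
Lemma cH_restriction n :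
  scalar_restriction (@cH R n) (@cH_inv R n) quat_of_complex complex_of_quat.
Proof.
apply: interleave_restriction.
- by move=> [? ? ? ?] [? ? ? ?].
- by move=> [? ? ? ?] [? ? ? ?].
- by move=> [? ? ? ?] [? ? ? ?].
- exact: (continuous_Complex (@qre_continuous R) (@qim_i_continuous R)).
- exact: (continuous_Complex (@qim_k_continuous R) (@qim_j_continuous R)).
- apply: continuous_Quat => p.
  + by apply: continuous_comp; [exact: cvg_fst | exact: Re_continuous].
  + by apply: continuous_comp; [exact: cvg_fst | exact: Im_continuous].
  + by apply: continuous_comp; [exact: cvg_snd | exact: Im_continuous].
  + by apply: continuous_comp; [exact: cvg_snd | exact: Re_continuous].
- by case.
- by move=> [? ?] [? ?].
- by move=> [? ?] [? ?].
- by move=> [? ? ? ?] [? ?]; congr Complex => /=; ring.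
- by move=> [? ? ? ?] [? ?]; congr Complex => /=; ring.
- by move=> [? ? ? ?] [? ? ? ?]; congr Complex => /=; ring.
Qed.

Lemma rH_restriction n : scalar_restriction (@rH R n) (@rH_inv R n)
  (quat_of_complex \o @real_complex R) (@complex.Re R \o complex_of_quat).
Proof.
exact: scalar_restriction_comp (cH_restriction n) (rC_restriction (2 * n)).
Qed.

End Restrictions.

(** * Index sets of the enlarged families as products *)

Section TwoSummands.
Variable I : finType.

(** The Boolean selects the factor: [false] for 1, [true] for the other basis element, i or j. *)
Definition pair_of_sum (s : I + I) : I * bool :=
  match s with inl l => (l, false) | inr l => (l, true) end.

Definition sum_of_pair (lb : I * bool) : I + I :=
  if lb.2 then inr lb.1 else inl lb.1.

Lemma pair_of_sumK : cancel pair_of_sum sum_of_pair.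
Proof. by case. Qed.

Lemma sum_of_pairK : cancel sum_of_pair pair_of_sum.
Proof. by case=> l []. Qed.

End TwoSummands.

Section FourSummands.
Variable I : finType.

(** [ord0] stands for the factor 1, and the lifted indices for i, j, k. *)
Definition pair_of_sum4 (s : I + I * 'I_3) : I * 'I_4 :=
  match s with inl l => (l, ord0) | inr (l, t) => (l, lift ord0 t) end.

Definition sum4_of_pair (lt : I * 'I_4) : I + I * 'I_3 :=
  if unlift ord0 lt.2 is Some t then inr (lt.1, t) else inl lt.1.

Lemma pair_of_sum4K : cancel pair_of_sum4 sum4_of_pair.
Proof.
by case=> [l|[l t]]; rewrite /sum4_of_pair /= ?unlift_none ?liftK.
Qed.

Lemma sum4_of_pairK : cancel sum4_of_pair pair_of_sum4.
Proof.
by case=> l t; rewrite /sum4_of_pair /=; case: unliftP => [t' ->|->].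
Qed.

End FourSummands.

(** * The three equivalences, each from an explicit basis *)

Lemma independent_complex_iff_real (R : realType) (n : nat) (I : finType)
    (v : I -> 'rV[R[i]]_n -> 'rV[R[i]]_n) :
  (forall l, continuous_nonvanishing (v l)) ->
  independent_vector_fields v <->
  independent_vector_fields (fun s : I + I =>
    match s with
    | inl l => @rC R n \o v l \o @rC_inv R n
    | inr l => @rC R n \o alpha (Complex 0 1) \o v l \o @rC_inv R n
    end).
Proof.
move=> v_cn; pose e (b : bool) : R[i] := if b then Complex 0 1 else 1.
apply: (@independent_vector_fields_restr _ _ _ _ _ _ _ _ (rC_restriction R n)
  _ _ _ _ _ e (fun b => if b then Complex 0 (-1) else 1)
  (fun z b => if b then complex.Im z else complex.Re z)
  _ _ _ _ _ _ _ _ _ (@pair_of_sumK I) (@sum_of_pairK I)).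
- by [].
- by [].
- by [].
- by move=> [a b]; rewrite /conjF /= => -[/eqP]; rewrite eqNr => /eqP -> ->.
- by case; rewrite /e ?mulr1 //; apply/eqP; rewrite eq_complex /=;
    apply/andP; split; apply/eqP; ring.
- by move=> b; exact: mulrr_continuous.
- move=> [a b]; rewrite big_bool /e /=; apply/eqP; rewrite eq_complex /=.
  by apply/andP; split; apply/eqP; ring.
- move=> d; rewrite big_bool /e /= => /eqP; rewrite eq_complex /=.
  move=> /andP[/eqP dr /eqP di].
  by case; [rewrite -di | rewrite -dr]; ring.
(* The real parts of q and qi are a and -b. *)
- move=> [a b] ab0; apply/eqP; rewrite eq_complex /=.
  have := ab0 true; have := ab0 false; rewrite /e /= => r0 i0.
  by apply/andP; split; apply/eqP;
    [rewrite -r0 | rewrite -[RHS]oppr0 -i0]; ring.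
- exact: v_cn.
- case=> l; apply/funext => y /=; first by rewrite /e alpha1.
  by [].
Qed.

Lemma quat_conj_fixed (R : realType) (q : quaternion R) :
  conjF q = q -> q = Quat (qre q) 0 0 0.
Proof.
have fix0 (x : R) : - x = x -> x = 0 by move=> /eqP; rewrite eqNr => /eqP.
by case: q => a b c d; rewrite /conjF /= => -[/fix0 -> /fix0 -> /fix0 ->].
Qed.

(** The identification [cH] uses the basis 1, k, but the fields are multiplied by j. As k = j(-i), 1
    and j also form a right C-basis. *)
Lemma independent_quaternionic_iff_complex (R : realType) (n : nat)
    (I : finType) (w : I -> 'rV[quaternion R]_n -> 'rV[quaternion R]_n) :
  (forall l, continuous_nonvanishing (w l)) ->
  independent_vector_fields w <->
  independent_vector_fields (fun s : I + I =>
    match s with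
    | inl l => @cH R n \o w l \o @cH_inv R n
    | inr l => @cH R n \o alpha (quat_j R) \o w l \o @cH_inv R n
    end).
Proof.
move=> w_cn; pose e (b : bool) : quaternion R := if b then quat_j R else 1.
(* q = a + b i + c j + d k = (a + b i) + j (c - d i) *)
pose coord (q : quaternion R) (b : bool) : R[i] :=
  if b then Complex (qim_j q) (- qim_k q) else Complex (qre q) (qim_i q).
apply: (@independent_vector_fields_restr _ _ _ _ _ _ _ _ (cH_restriction R n)
  _ _ _ _ _ e (fun b => if b then - quat_j R else 1) coord
  _ _ _ _ _ _ _ _ _ (@pair_of_sumK I) (@sum_of_pairK I)).
- by [].
- by [].
- by [].
- by move=> q /quat_conj_fixed -> -[/= ->].
- by case; rewrite /e ?mulr1 //; congr Quat; rewrite /=; ring.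
- by move=> b; exact: quat_mulr_continuous.
- by move=> [a b c d]; rewrite big_bool /e /=; congr Quat; rewrite /=; ring.
- move=> d; rewrite big_bool /e.
  case Et: (d true) => [p q]; case Ef: (d false) => [r s] sum0.
  have := congr1 (@qre R) sum0; have := congr1 (@qim_i R) sum0.
  have := congr1 (@qim_j R) sum0; have := congr1 (@qim_k R) sum0.
  move=> /= zk zj zi zr.
  case; rewrite ?Et ?Ef; congr Complex.
  + by rewrite -zj; ring.
  + by rewrite -[RHS]oppr0 -zk; ring.
  + by rewrite -zr; ring.
  + by rewrite -zi; ring.
(* The complex parts of q and qj are a + bi and -c - di, which together contain all four
   coordinates. *)
- move=> [a b c d] q0.
  have := q0 true; have := q0 false.
  rewrite /e /complex_of_quat /= => -[z1 zi] [zj zk]; congr Quat.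
  + by rewrite -z1; ring.
  + by rewrite -zi; ring.
  + by rewrite -[RHS]oppr0 -zj; ring.
  + by rewrite -[RHS]oppr0 -zk; ring.
- exact: w_cn.
- case=> l; apply/funext => y /=; first by rewrite /e alpha1.
  by [].
Qed.

Lemma independent_quaternionic_iff_real (R : realType) (n : nat)
    (I : finType) (w : I -> 'rV[quaternion R]_n -> 'rV[quaternion R]_n) :
  (forall l, continuous_nonvanishing (w l)) ->
  independent_vector_fields w <->
  independent_vector_fields (fun s : I + I * 'I_3 =>
    match s with
    | inl l => @rH R n \o w l \o @rH_inv R n
    | inr (l, t) =>
        @rH R n \o alpha [:: quat_i R; quat_j R; quat_k R]`_t \o w l
          \o @rH_inv R n
    end).
Proof.
move=> w_cn.
pose e (t : 'I_4) := [:: 1; quat_i R; quat_j R; quat_k R]`_t.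
pose coord (q : quaternion R) (t : 'I_4) :=
  [:: qre q; qim_i q; qim_j q; qim_k q]`_t.
(* The elements 1, i, j, k have norm 1, so conjugation inverts them. *)
apply: (@independent_vector_fields_restr _ _ _ _ _ _ _ _ (rH_restriction R n)
  _ _ _ _ _ e (fun t => conjF (e t)) coord
  _ _ _ _ _ _ _ _ _ (@pair_of_sum4K I) (@sum4_of_pairK I)).
- by [].
- by [].
- by [].
- by move=> q /quat_conj_fixed -> /= ->.
- by case=> [] [|[|[|[|?]]]] //= ?; rewrite /e /conjF /=; congr Quat;
    rewrite /=; ring.
- by move=> b; exact: quat_mulr_continuous.
- move=> [a b c d]; rewrite !big_ord_recl big_ord0 /e /coord /=.
  by congr Quat; rewrite /=; ring.
- move=> d; rewrite !big_ord_recl big_ord0 /e => sum0.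
  have := congr1 (@qre R) sum0; have := congr1 (@qim_i R) sum0.
  have := congr1 (@qim_j R) sum0; have := congr1 (@qim_k R) sum0.
  move=> /= zk zj zi zr t.
  (* The indices 0, 1, 2 are peeled off in turn, each settled by one real coordinate of the
     vanishing sum. *)
  have [t1|->] := unliftP ord0 t; last by rewrite -zr; ring.
  move=> ->; have [t2|->] := unliftP ord0 t1; last by rewrite -zi; ring.
  move=> ->; have [t3|->] := unliftP ord0 t2; last by rewrite -zj; ring.
  by move=> ->; rewrite (ord1 t3) -zk; ring.
(* The real parts of q, qi, qj, qk are a, -b, -c, -d. *)
- move=> [a b c d] q0.
  have := q0 ord0; have := q0 (lift ord0 ord0).
  have := q0 (lift ord0 (lift ord0 ord0)).
  have := q0 (lift ord0 (lift ord0 (lift ord0 ord0))).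
  rewrite /e /= => zk zj zi zr; congr Quat.
  + by rewrite -zr; ring.
  + by rewrite -[RHS]oppr0 -zi; ring.
  + by rewrite -[RHS]oppr0 -zj; ring.
  + by rewrite -[RHS]oppr0 -zk; ring.
- exact: w_cn.
- case=> [l|[l t]]; apply/funext => y /=; first by rewrite /e alpha1.
  by [].
Qed.

Theorem theorem2p5 (R : realType) (n m : nat) (n_gt0 : (0 < n)%N)
    (m_gt0 : (0 < m)%N)
    (v : 'I_m -> 'rV[R[i]]_n -> 'rV[R[i]]_n)
    (w : 'I_m -> 'rV[quaternion R]_n -> 'rV[quaternion R]_n)
    (hv : forall l, continuous_nonvanishing (v l))
    (hw : forall l, continuous_nonvanishing (w l)) :
  [/\ independent_vector_fields v <->
      independent_vector_fields (fun s : 'I_m + 'I_m =>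
        match s with
        | inl l => @rC R n \o v l \o @rC_inv R n
        | inr l => @rC R n \o alpha (Complex 0 1) \o v l \o @rC_inv R n
        end),
      independent_vector_fields w <->
      independent_vector_fields (fun s : 'I_m + 'I_m =>
        match s with
        | inl l => @cH R n \o w l \o @cH_inv R n
        | inr l => @cH R n \o alpha (quat_j R) \o w l \o @cH_inv R n
        end)
    & independent_vector_fields w <->
      independent_vector_fields (fun s : 'I_m + 'I_m * 'I_3 =>
        match s with
        | inl l => @rH R n \o w l \o @rH_inv R n
        | inr (l, t) =>
            @rH R n \o alpha [:: quat_i R; quat_j R; quat_k R]`_t \o w l
              \o @rH_inv R n
        end)].
Proof.
split.
- exact: independent_complex_iff_real.
- exact: independent_quaternionic_iff_complex.
- exact: independent_quaternionic_iff_real.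
Qed.
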